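(* Assume $f$ satisfies (A1), (A2), (A3), (A4) with $k=1$, let $\bar\lambda_1=\lambda+2\tau_1\mathsf D$, and assume $$200\min\{\mu,(\bar\lambda_1\rho_1)^{1/2}\}\,\mathsf D\le\varepsilon.$$ Let $x_0\in X$, $\hat y\in Y$. Run Algorithm 2 with $\gamma_x=\frac{1}{3\bar\lambda_1+\mu^2/\rho_1}$, $\mathsf{Coupled}=\mathbb 1\{\mu\ge(\bar\lambda_1\rho_1)^{1/2}\}$, $\gamma_y=1/\rho_1$ if $\mathsf{Coupled}=1$, and $$T\ge\Big(3+\frac{\mu^2}{\bar\lambda_1\rho_1}\Big)\Big(\frac{700\bar\lambda_1\Delta}{\varepsilon^2}+1\Big)$$ iterations, where $\Delta=\varphi(x_0)-\min_{x\in X}\varphi(x)$. Then the output $x^*\in X$ satisfies $\|\nabla\varphi_{2\bar\lambda_1}(x^* )\|\le\varepsilon$.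
   Context: Let $E_x,E_y$ be finite-dimensional Euclidean spaces with Euclidean norms $\|\cdot\|$ (operator norms for tensors). Let $X\subseteq E_x$, $Y\subseteq E_y$ be convex with nonempty interior, $Y$ compact, $\mathsf D\ge\mathrm{diam}(Y)$. Let $f:X\times Y\to\mathbb R$ and $\varphi(x)=\max_{y\in Y}f(x,y)$. (A1) $\nabla_x f$ exists and $\|\nabla_x f(x',y')-\nabla_x f(x,y)\|\le\lambda\|x'-x\|+\mu\|y'-y\|$ for all $x,x'\in X,y,y'\in Y$ ($\lambda>0,\mu\ge0$). (A2) with $k=1$: $\nabla_y f$ exists and $\|\nabla_y f(x',y')-\nabla_y f(x,y)\|\le\rho_1\|y'-y\|+\sigma_1\|x'-x\|$. (A3) with $k=1$: $\nabla^2_{xy}f$ exists and $\|\nabla^2_{xy}f(x',y)-\nabla^2_{xy}f(x,y)\|\le\tau_1\|x'-x\|$. (A4) with $k=1$: with $Y'_x$ the set of $y\in Y$ at which the third-order partial derivative tensor $\nabla^3_{xxy}f(x,y)$ does not exist, the set $\{(x,y):x\in X,y\in Y'_x\}$ is Lebesgue measurable. For a weakly convex $\phi:X\to\mathbb R$ (i.e. $\phi+\frac{c}{2}\|\cdot\|^2$ convex for some $c<\bar\lambda$), its Moreau envelope is $\phi_{\bar\lambda}(x)=\min_{u\in X}\{\phi(u)+\frac{\bar\lambda}2\|u-x\|^2\}$. $\Pi_X,\Pi_Y$ denote Euclidean projections. Algorithm 2 (input $x_0\in X$, $\hat y\in Y$, $\gamma_x>0$, $T$, $\mathsf{Coupled}\in\{0,1\}$,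 $\gamma_y>0$): set $x^*=x_0$, $\varepsilon^*=+\infty$. For $t=0,\dots,T-1$: if $\mathsf{Coupled}=1$, set $y_t=\Pi_Y[\hat y+\gamma_y\nabla_y f(x_t,\hat y)]$ and $\tilde x_{t+1}=x_t-\gamma_x[\nabla_x f(x_t,\hat y)+\nabla^2_{xy}f(x_t,\hat y)(y_t-\hat y)]$; otherwise choose $y_t\in\operatorname{Argmax}_{y\in Y}\langle\nabla_y f(x_t,\hat y),y\rangle$ and set $\tilde x_{t+1}=x_t-\gamma_x\nabla_x f(x_t,y_t)$. Then $x_{t+1}=\Pi_X[\tilde x_{t+1}]$, $\varepsilon_t^2=\frac1{\gamma_x^2}\|\tilde x_{t+1}-x_t\|^2-\frac1{\gamma_x^2}\|\tilde x_{t+1}-x_{t+1}\|^2$, and if $\varepsilon_t<\varepsilon^*$ set $x^*=x_t$, $\varepsilon^*=\varepsilon_t$. Output $x^*$. *)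

(* Defs.v *)
From HB Require Import structures.
From mathcomp Require Import all_boot all_order all_algebra.
From mathcomp Require Import all_classical all_reals all_analysis.
Set Implicit Arguments. Unset Strict Implicit. Unset Printing Implicit Defensive.
Import Order.TTheory GRing.Theory Num.Theory.
Import numFieldNormedType.Exports.
Local Open Scope classical_set_scope.
Local Open Scope ring_scope.

(* Finite-dimensional Euclidean spaces are modelled as row vectors 'rV[R]_n
   with the standard inner product. *)
Section Euclid.
Variable R : realType.

Definition dot (n : nat) (u v : 'rV[R]_n) : R := \sum_(i < n) u 0 i * v 0 i.
Definition enorm (n : nat) (u : 'rV[R]_n) : R := Num.sqrt (dot u u).

(* Operator norm of A : 'M_(m,n), viewed as the linear map v |-> v *m A
   from E_y = 'rV_m to E_x = 'rV_n (Euclidean norms on both sides). *)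
Definition opnorm (m n : nat) (A : 'M[R]_(m, n)) : R :=
  sup [set enorm (v *m A) | v in [set v : 'rV[R]_m | enorm v <= 1]].

Definition is_projection (n : nat) (S : set 'rV[R]_n) (p : 'rV[R]_n -> 'rV[R]_n) : Prop :=
  forall z, S (p z) /\ forall u, S u -> enorm (z - p z) <= enorm (z - u).

Definition is_gradient (n : nat) (F : 'rV[R]_n -> R) (x g : 'rV[R]_n) : Prop :=
  forall e : R, 0 < e -> exists d : R, 0 < d /\
    forall h, enorm h < d -> `|F (x + h) - F x - dot g h| <= e * enorm h.

(* Gradient of F at x relative to a set S (x in S); for a convex S with
   nonempty interior it is unique. *)
Definition is_gradient_within (n : nat) (S : set 'rV[R]_n) (F : 'rV[R]_n -> R)
  (x g : 'rV[R]_n) : Prop :=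
  forall e : R, 0 < e -> exists d : R, 0 < d /\
    forall x', S x' -> enorm (x' - x) < d ->
      `|F x' - F x - dot g (x' - x)| <= e * enorm (x' - x).

Definition is_jacobian_within (m n : nat) (S : set 'rV[R]_m)
  (G : 'rV[R]_m -> 'rV[R]_n) (y : 'rV[R]_m) (J : 'M[R]_(m, n)) : Prop :=
  forall e : R, 0 < e -> exists d : R, 0 < d /\
    forall y', S y' -> enorm (y' - y) < d ->
      enorm (G y' - G y - (y' - y) *m J) <= e * enorm (y' - y).

(* Derivative (a linear map 'rV_n -> 'M_(m,n), given by its values L i on the
   standard basis) of a matrix-valued map H at x, relative to S,
   measured in operator norm. *)
Definition is_mx_derivative_within (n m : nat) (S : set 'rV[R]_n)
  (H : 'rV[R]_n -> 'M[R]_(m, n)) (x : 'rV[R]_n) (L : 'I_n -> 'M[R]_(m, n)) : Prop :=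
  forall e : R, 0 < e -> exists d : R, 0 < d /\
    forall x', S x' -> enorm (x' - x) < d ->
      opnorm (H x' - H x - \sum_(i < n) (x' - x) 0 i *: L i) <= e * enorm (x' - x).

(* Lebesgue measurability in R^d = 'rV_d, via Lebesgue outer measure
   (countable covers by closed boxes) and Caratheodory's criterion. *)
Definition box (d : nat) (a b : 'rV[R]_d) : set 'rV[R]_d :=
  [set x | forall i, a 0 i <= x 0 i <= b 0 i].
Definition box_vol (d : nat) (a b : 'rV[R]_d) : R :=
  \prod_(i < d) Num.max 0 (b 0 i - a 0 i).
Definition lebesgue_outer (d : nat) (E : set 'rV[R]_d) : \bar R :=
  ereal_inf [set s | exists a b : nat -> 'rV[R]_d,
     E `<=` \bigcup_k box (a k) (b k) /\
     s = (\sum_(0 <= k <oo) (box_vol (a k) (b k))%:E)%E].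
Definition lebesgue_measurable_set (d : nat) (A : set 'rV[R]_d) : Prop :=
  forall E : set 'rV[R]_d,
    lebesgue_outer E = (lebesgue_outer (E `&` A) + lebesgue_outer (E `&` ~` A))%E.

Definition maxfun (n m : nat) (f : 'rV[R]_n -> 'rV[R]_m -> R) (Y : set 'rV[R]_m)
  (x : 'rV[R]_n) : R := sup [set f x y | y in Y].

Definition moreau (n : nat) (phi : 'rV[R]_n -> R) (X : set 'rV[R]_n) (lam : R)
  (x : 'rV[R]_n) : R :=
  inf [set phi u + lam / 2 * enorm (u - x) ^+ 2 | u in X].

(* Record-keeping loop of Algorithm 2: after processing iterations 0..t-1,
   the pair (xstar, epsstar), starting from (x_0, +oo). *)
Fixpoint alg2_best (n : nat) (x : nat -> 'rV[R]_n) (eps : nat -> R) (t : nat)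
  : 'rV[R]_n * \bar R :=
  match t with
  | 0 => (x 0%N, +oo%E)
  | t'.+1 => let b := alg2_best x eps t' in
             if ((eps t')%:E < b.2)%E then (x t', (eps t')%:E) else b
  end.

End Euclid.

(* Main.v *)
Require Import Defs.
From HB Require Import structures.
From mathcomp Require Import all_boot all_order all_algebra.
From mathcomp Require Import all_classical all_reals all_analysis.
From mathcomp Require Import ring lra zify.
Set Implicit Arguments.
Unset Strict Implicit.
Unset Printing Implicit Defensive.
Import Order.TTheory GRing.Theory Num.Theory.
Import numFieldNormedType.Exports.
Local Open Scope classical_set_scope.
Local Open Scope ring_scope.

(* Both variants of the algorithm are inexact projected gradient descent on
   phi = max_y f(., y).  Let lb = lambda + 2 tau1 D.
   Uncoupled: all gradients gx(x, y), y in Y, lie within mu D of each other, so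
   phi obeys two-sided quadratic bounds along gx(x_t, y_t) up to mu D |u - x|.
   Coupled: psi(x) = max_y f(x, yhat) + <gy(x, yhat), y - yhat> - rho1/2 |y - yhat|^2
   satisfies psi <= phi <= psi + rho1 D^2, is (lb + mu^2/rho1)-smooth from above and
   lb-smooth from below, and the step direction is its gradient.
   In both cases telescoping bounds the smallest eps_t.  Since
   eps_t^2 = max_{u in X} gamma^-2 (|xt - x_t|^2 - |xt - u|^2), testing u on the
   segment from x_t to p = prox_phi(x_t) bounds 2 lb |x_t - p|, the norm of the
   gradient of the Moreau envelope. *)

Section EuclideanGeometry.
Context {R : realType}.

(** * Inner product, Euclidean norm and Cauchy-Schwarz *)

Section InnerProduct.
Context {n : nat}.
Implicit Types u v w : 'rV[R]_n.

Lemma dotC u v : dot u v = dot v u.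
Proof. by apply: eq_bigr => i _; rewrite mulrC. Qed.

Lemma dotDl u v w : dot (u + v) w = dot u w + dot v w.
Proof. by rewrite -big_split; apply: eq_bigr => i _; rewrite mxE mulrDl. Qed.

Lemma dotZl a u w : dot (a *: u) w = a * dot u w.
Proof. by rewrite /dot mulr_sumr; apply: eq_bigr => i _; rewrite mxE mulrA. Qed.

Lemma dotNl u w : dot (- u) w = - dot u w.
Proof. by rewrite -scaleN1r dotZl mulN1r. Qed.

Lemma dotDr u v w : dot w (u + v) = dot w u + dot w v.
Proof. by rewrite dotC dotDl !(dotC _ w). Qed.

Lemma dotZr a u w : dot w (a *: u) = a * dot w u.
Proof. by rewrite dotC dotZl dotC. Qed.

Lemma dotNr u w : dot w (- u) = - dot w u.
Proof. by rewrite dotC dotNl dotC. Qed.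

Definition dotE := (dotDl, dotDr, dotNl, dotNr, dotZl, dotZr).

Lemma dotvv_ge0 u : 0 <= dot u u.
Proof. by apply: sumr_ge0 => i _; rewrite -expr2 sqr_ge0. Qed.

Lemma enorm_ge0 u : 0 <= enorm u.
Proof. exact: sqrtr_ge0. Qed.

Lemma enorm_sqr u : enorm u ^+ 2 = dot u u.
Proof. by rewrite /enorm sqr_sqrtr ?dotvv_ge0. Qed.

Lemma enorm0 : enorm (0 : 'rV[R]_n) = 0.
Proof. by rewrite /enorm /dot big1 ?sqrtr0 // => i _; rewrite mxE mul0r. Qed.

Lemma enorm0_eq0 u : enorm u = 0 -> u = 0.
Proof.
move=> u0; have /eqP := enorm_sqr u.
rewrite u0 expr0n eq_sym /dot psumr_eq0 => [/allP h|i _]; last first.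
  by rewrite -expr2 sqr_ge0.
apply/rowP => i; rewrite mxE; apply/eqP.
by have := h i; rewrite mem_index_enum mulf_eq0 orbb => /(_ isT).
Qed.

Lemma cauchy_schwarz u v : `|dot u v| <= enorm u * enorm v.
Proof.
have q s t : 0 <= s ^+ 2 * enorm u ^+ 2 + 2 * s * t * dot u v + t ^+ 2 * enorm v ^+ 2.
  have := dotvv_ge0 (s *: u + t *: v).
  by rewrite !dotE !enorm_sqr (dotC v u); nra.
have [u0|un0] := eqVneq (enorm u) 0.
  by rewrite (enorm0_eq0 u0) -(scale0r v) dotZl mul0r normr0 scale0r enorm0 mul0r.
have [v0|vn0] := eqVneq (enorm v) 0.
  by rewrite (enorm0_eq0 v0) -(scale0r u) dotZr mul0r normr0 scale0r enorm0 mulr0.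
have up : 0 < enorm u by rewrite lt_def un0 enorm_ge0.
have vp : 0 < enorm v by rewrite lt_def vn0 enorm_ge0.
have up2 : 0 < enorm u * enorm v by rewrite mulr_gt0.
rewrite ler_norml; apply/andP; split.
  by rewrite -(ler_pM2l up2); have := q (enorm v) (enorm u); nra.
by rewrite -(ler_pM2l up2); have := q (enorm v) (- enorm u); nra.
Qed.

Lemma dot_le u v : dot u v <= enorm u * enorm v.
Proof. exact: le_trans (ler_norm _) (cauchy_schwarz u v). Qed.

Lemma enormZ a u : enorm (a *: u) = `|a| * enorm u.
Proof. by rewrite /enorm dotZl dotZr mulrA -expr2 sqrtrM ?sqr_ge0 // sqrtr_sqr. Qed.

Lemma enormN u : enorm (- u) = enorm u.
Proof. by rewrite -scaleN1r enormZ normrN1 mul1r. Qed.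

Lemma enormB u v : enorm (u - v) = enorm (v - u).
Proof. by rewrite -enormN opprB. Qed.

Lemma enormD u v : enorm (u + v) <= enorm u + enorm v.
Proof.
rewrite -(@ler_pXn2r _ 2) ?nnegrE ?addr_ge0 ?enorm_ge0 //.
rewrite enorm_sqr !dotE sqrrD !enorm_sqr (dotC v u).
have := dot_le u v; lra.
Qed.

Lemma coord_le_enorm u i : `|u 0 i| <= enorm u.
Proof.
rewrite -sqrtr_sqr ler_wsqrtr // /dot (bigD1 i) //= -expr2 lerDl.
by apply: sumr_ge0 => j _; rewrite -expr2 sqr_ge0.
Qed.

End InnerProduct.

(** * Matrices acting on row vectors *)

Lemma dot_mulmx m n (v : 'rV[R]_m) (J : 'M[R]_(m, n)) (w : 'rV[R]_n) :
  dot (v *m J) w = dot (w *m J^T) v.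
Proof.
rewrite /dot (eq_bigr (fun j => \sum_i v 0 i * J i j * w 0 j)); last first.
  by move=> j _; rewrite mxE mulr_suml.
rewrite exchange_big /=; apply: eq_bigr => i _.
rewrite !mxE mulr_suml; apply: eq_bigr => j _; rewrite !mxE; ring.
Qed.

(** Some finite bound, here the Frobenius norm, makes the [sup] in [opnorm] a genuine upper
    bound. *)
Lemma enorm_mulmx_bounded m n (A : 'M[R]_(m, n)) :
  exists C : R, forall v : 'rV[R]_m, enorm (v *m A) <= C * enorm v.
Proof.
exists (Num.sqrt (\sum_(j < n) dot (col j A)^T (col j A)^T)) => v.
have S0 : 0 <= \sum_(j < n) dot (col j A)^T (col j A)^T.
  by apply: sumr_ge0 => j _; exact: dotvv_ge0.
rewrite /enorm -sqrtrM // ler_wsqrtr // {1}/dot mulr_suml ler_sum // => j _.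
have -> : (v *m A) 0 j = dot v (col j A)^T.
  by rewrite mxE; apply: eq_bigr => i _; rewrite !mxE.
rewrite -expr2 -real_normK ?num_real // mulrC -!enorm_sqr -exprMn.
by rewrite ler_pXn2r ?nnegrE ?mulr_ge0 ?enorm_ge0 // cauchy_schwarz.
Qed.

Lemma enorm_mulmx_opnorm m n (A : 'M[R]_(m, n)) (v : 'rV[R]_m) :
  enorm (v *m A) <= opnorm A * enorm v.
Proof.
have [v0|vn0] := eqVneq (enorm v) 0.
  by rewrite (enorm0_eq0 v0) mul0mx !enorm0 mulr0.
have vp : 0 < enorm v by rewrite lt_def vn0 enorm_ge0.
rewrite -ler_pdivrMr //.
have -> : enorm (v *m A) / enorm v = enorm (((enorm v)^-1 *: v) *m A).
  by rewrite -scalemxAl enormZ ger0_norm ?invr_ge0 ?enorm_ge0 // mulrC.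
have [C hC] := enorm_mulmx_bounded A.
apply: ub_le_sup; last first.
  exists ((enorm v)^-1 *: v) => //=.
  by rewrite enormZ ger0_norm ?invr_ge0 ?enorm_ge0 // mulVf.
exists `|C| => _ [u /= u1 <-].
apply: le_trans (hC u) _; apply: le_trans (ler_wpM2r (enorm_ge0 _) (ler_norm C)) _.
by rewrite ler_piMr.
Qed.

(** * Convex sets and Euclidean projections *)

Lemma convex_set_segment n (S : set 'rV[R]_n) a b (s : R) :
  convex_set S -> S a -> S b -> 0 <= s <= 1 -> S (a + s *: (b - a)).
Proof.
move=> cS Sa Sb /andP[s0 s1].
have := cS b a (Itv01 s0 s1) (mem_set Sb) (mem_set Sa).
rewrite inE /conv/= /convex.conv/=; congr S.
by rewrite /unstable.onem scalerBl scale1r scalerBr addrCA.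
Qed.

(** First-order optimality: a short move from [proj z] towards [u] stays in [S], hence cannot come
    closer to [z]. *)
Lemma projection_obtuse n (S : set 'rV[R]_n) proj z u :
  convex_set S -> is_projection S proj -> S u ->
  dot (z - proj z) (u - proj z) <= 0.
Proof.
move=> cS /(_ z) [Sp pP] Su; set p := proj z in Sp pP *.
rewrite leNgt; apply/negP => c_gt0; set c := dot _ _ in c_gt0.
set N := dot (u - p) (u - p); have N0 : 0 <= N := dotvv_ge0 _.
have step s : 0 <= s <= 1 -> 2 * s * c <= s ^+ 2 * N.
  move=> s01; have := ler_pM (enorm_ge0 _) (enorm_ge0 _)
    (pP _ (convex_set_segment cS Sp Su s01)) (pP _ (convex_set_segment cS Sp Su s01)).
  rewrite -!expr2 !enorm_sqr opprD addrA /N /c.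
  set a := z - p; set d := u - p.
  by rewrite (dotDl a) !(dotDr a) !dotNl !dotNr !dotZl !dotZr (dotC d a); nra.
(* This [s] lies in [[0, 1]] even when [N = 0], and turns [step] into
   [2 c^2 <= c^2 N / (c + N) <= c^2], absurd for [c > 0]. *)
have := step (c / (c + N)).
have cN : 0 < c + N by lra.
have -> : 0 <= c / (c + N) <= 1.
  by rewrite divr_ge0 ?(ltW c_gt0) ?(ltW cN) //= ler_pdivrMr // mul1r lerDl.
move=> /(_ isT); rewrite expr2 -mulrA -(ler_pM2r cN).
have -> : 2 * (c / (c + N) * c) * (c + N) = 2 * c ^+ 2 by field; lra.
have -> : c / (c + N) * (c / (c + N)) * N * (c + N) = c ^+ 2 * (N / (c + N)).
  by field; lra.
have : N / (c + N) <= 1 by rewrite ler_pdivrMr // mul1r lerDr ltW.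
by set q := N / _; nra.
Qed.

(** * Derivatives and the mean value theorem on the unit interval *)

(** One-sided at the endpoints, to match gradients known only relative to [X] or [Y] along segments
    that may touch the boundary. *)
Definition derive_within01 (k : R -> R) (s l : R) : Prop :=
  forall e : R, 0 < e -> exists d : R, 0 < d /\
    forall s', 0 <= s' <= 1 -> `|s' - s| < d ->
      `|k s' - k s - l * (s' - s)| <= e * `|s' - s|.

Lemma derive_within01D k1 k2 s l1 l2 :
  derive_within01 k1 s l1 -> derive_within01 k2 s l2 ->
  derive_within01 (fun r => k1 r + k2 r) s (l1 + l2).
Proof.
move=> h1 h2 e e0; have e20 : 0 < e / 2 by lra.
have [d1 [d10 H1]] := h1 _ e20; have [d2 [d20 H2]] := h2 _ e20.
exists (Num.min d1 d2); split; first by rewrite lt_min d10.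
move=> s' s'01; rewrite lt_min => /andP[l1' l2'].
have := H1 _ s'01 l1'; have := H2 _ s'01 l2'.
set a1 := k1 _ - _ - _; set a2 := k2 _ - _ - _ => h4 h3.
have -> : k1 s' + k2 s' - (k1 s + k2 s) - (l1 + l2) * (s' - s) = a1 + a2.
  by rewrite /a1 /a2; ring.
apply: le_trans (ler_normD _ _) _; lra.
Qed.

Lemma derive_within01_quadratic (a q s : R) :
  derive_within01 (fun r => a * r + q * r ^+ 2) s (a + 2 * q * s).
Proof.
move=> e e0; exists (e / (1 + `|q|)).
have q0 : 0 < 1 + `|q| by have := normr_ge0 q; lra.
split=> [|s' _]; first by rewrite divr_gt0.
rewrite ltr_pdivlMr // => h.
have -> : a * s' + q * s' ^+ 2 - (a * s + q * s ^+ 2) - (a + 2 * q * s) * (s' - s)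
   = q * (s' - s) * (s' - s) by ring.
rewrite !normrM ler_wpM2r //; have := normr_ge0 (s' - s); have := normr_ge0 q; nra.
Qed.

Lemma derive_within01_mvt (k k' : R -> R) :
  (forall s, 0 <= s <= 1 -> derive_within01 k s (k' s)) ->
  exists2 c, 0 <= c <= 1 & k 1 - k 0 = k' c.
Proof.
move=> hk.
have [||c c01 ->] := @MVT R k k' 0 1 ltr01; last first.
- by exists c; rewrite ?subr0 ?mulr1 //; move: c01; rewrite in_itv/= => /andP[/ltW-> /ltW->].
- apply/subspace_continuousP => s /=; rewrite in_itv/= => s01.
  apply/cvgrPdist_le => e e0.
  have [d [d0 H]] := hk s s01 1 ltr01.
  have l0 : 0 < 1 + `|k' s| by have := normr_ge0 (k' s); lra.
  rewrite near_withinE; near=> z => /=; rewrite in_itv/= => z01.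
  have zs : `|z - s| < d.
    by rewrite distrC; near: z; exact: cvgr_dist_lt.
  have zs2 : `|z - s| < e / (1 + `|k' s|).
    by rewrite distrC; near: z; apply: cvgr_dist_lt => //; rewrite divr_gt0.
  have h := H z z01 zs; rewrite ltr_pdivlMr // in zs2.
  rewrite distrC.
  have -> : k z - k s = (k z - k s - k' s * (z - s)) + k' s * (z - s) by ring.
  apply: le_trans (ler_normD _ _) _; rewrite normrM; lra.
- move=> s; rewrite in_itv/= => /andP[s0 s1].
  have s01 : 0 <= s <= 1 by rewrite !ltW.
  have cv : (fun h => h^-1 *: ((k \o shift s) (h *: 1) - k s)) @ 0^' --> k' s.
    apply/cvgrPdist_le => e e0.
    have [d [d0 H]] := hk s s01 e e0.
    near=> h.
    have hn0 : h != 0 by near: h; exact: nbhs_dnbhs_neq.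
    (* The bounds [s] and [1 - s] keep [h + s] in [[0, 1]], where the relative derivative
       applies. *)
    have hs : `|h| < Num.min d (Num.min s (1 - s)).
      near: h; apply: dnbhs0_lt; rewrite !lt_min d0 s0; lra.
    move: hs; rewrite !lt_min => /and3P[hd hs hs1].
    have := H (h + s); rewrite addrK => /(_ _ hd) hh.
    have /hh : 0 <= h + s <= 1.
      by move: hs hs1; rewrite !ltr_norml => /andP[? ?] /andP[? ?]; lra.
    rewrite /= [h *: 1]mulr1 distrC => h1.
    rewrite -(@ler_pM2r _ `|h|) ?normr_gt0 // -normrM.
    apply: le_trans h1; rewrite le_eqVlt; apply/orP; left; apply/eqP; congr `|_|.
    by rewrite /GRing.scale/= mulrBl mulrAC mulVf // mul1r.
  by apply: DeriveDef; [apply/cvg_ex; exists (k' s)|exact/cvg_lim].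
Unshelve. all: by end_near.
Qed.

Lemma derive_within01N k s l :
  derive_within01 k s l -> derive_within01 (fun r => - k r) s (- l).
Proof.
move=> hk e /hk[d [d0 H]]; exists d; split=> // s' s'01 /(H _ s'01).
by rewrite mulNr -!opprD normrN.
Qed.

(** Turns Lipschitz-type bounds on finite differences into bounds on the derivative, by dividing by
    a small [h]. *)
Lemma derive_within01_norm_le (k : R -> R) (l C : R) : derive_within01 k 0 l ->
  (forall h, 0 < h <= 1 -> `|k h - k 0| <= h * C) -> `|l| <= C.
Proof.
move=> hk hC; apply/ler_addgt0Pr => e e0; have [d [d0 H]] := hk _ e0.
pose h := Num.min (d / 2) 1.
have h0 : 0 < h by rewrite lt_min; lra.
have hd : h <= d / 2 by rewrite ge_min lexx.
have h1 : h <= 1 by rewrite ge_min lexx orbT.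
have h01 : 0 <= h <= 1 by rewrite h1 ltW.
have := H h h01; rewrite subr0 gtr0_norm // => /(_ _).
have hd' : h < d by lra.
move=> /(_ hd') lo.
have /hC up : 0 < h <= 1 by rewrite h0.
rewrite -(ler_pM2r h0).
have : `|l * h| <= `|k h - k 0| + `|k h - k 0 - l * h|.
  by rewrite -{1}(subKr (k h - k 0) (l * h)) ler_normB.
rewrite normrM (gtr0_norm h0); lra.
Qed.

(** * Smoothness along segments of a convex set *)

Section Segment.
Context {n : nat} (S : set 'rV[R]_n) (convS : convex_set S).

Lemma derive_within01_segment (F : 'rV[R]_n -> R) (a b g : 'rV[R]_n) s :
  S a -> S b -> is_gradient_within S F (a + s *: (b - a)) g ->
  derive_within01 (fun r => F (a + r *: (b - a))) s (dot g (b - a)).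
Proof.
move=> Sa Sb hF e e0; set w := b - a; have w0 := enorm_ge0 w.
have w1 : 0 < 1 + enorm w by lra.
have e'0 : 0 < e / (1 + enorm w) by rewrite divr_gt0.
have [d [d0 H]] := hF _ e'0.
exists (d / (1 + enorm w)); split; first by rewrite divr_gt0.
move=> s' s'01; rewrite ltr_pdivlMr // => hs.
have Ss' := convex_set_segment convS Sa Sb s'01.
have E : a + s' *: w - (a + s *: w) = (s' - s) *: w.
  by rewrite opprD addrACA subrr add0r -scalerBl.
have := H _ Ss'; rewrite E enormZ dotZr => h.
have := normr_ge0 (s' - s) => n0.
have /h : `|s' - s| * enorm w < d by nra.
rewrite mulrC; move/le_trans; apply; rewrite mulrAC ler_pdivrMr // -!mulrA; nra.
Qed.

(** No integration: the mean value theorem is applied to [F] along the segment plus [A s + q s^2],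
    whose derivative offsets the linear growth of the gradient gap and yields the sharp factor
    [L / 2]. *)
Lemma smooth_quadratic_bound (F : 'rV[R]_n -> R) (G : 'rV[R]_n -> 'rV[R]_n) (L : R) a b :
  S a -> S b ->
  (forall z, S z -> is_gradient_within S F z (G z)) ->
  (forall z, S z -> enorm (G z - G a) <= L * enorm (z - a)) ->
  `|F b - F a - dot (G a) (b - a)| <= L / 2 * enorm (b - a) ^+ 2.
Proof.
move=> Sa Sb gF LG; set w := b - a.
pose z s := a + s *: w.
have Sz s : 0 <= s <= 1 -> S (z s) by move=> /(convex_set_segment convS Sa Sb).
have gap s : 0 <= s <= 1 -> `|dot (G (z s)) w - dot (G a) w| <= L * s * enorm w ^+ 2.
  move=> s01; rewrite -dotNl -dotDl; apply: le_trans (cauchy_schwarz _ _) _.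
  have := LG _ (Sz _ s01).
  rewrite /z (addrC a) addrK enormZ ger0_norm; last by case/andP: s01.
  by move=> /(ler_wpM2r (enorm_ge0 w)); rewrite expr2 !mulrA.
have key (A q : R) : exists2 c, 0 <= c <= 1 &
    F b - F a + A + q = dot (G (z c)) w + (A + 2 * q * c).
  have [s s01|c c01 e] := @derive_within01_mvt
      (fun s => F (z s) + (A * s + q * s ^+ 2))
      (fun s => dot (G (z s)) w + (A + 2 * q * s)).
    apply: derive_within01D; last exact: derive_within01_quadratic.
    by apply: derive_within01_segment => //; apply: gF; exact: Sz.
  exists c => //; rewrite -e /z scale1r scale0r addr0 /w (addrC a) subrK; ring.
rewrite ler_norml; apply/andP; split.
- have [c c01] := key (- dot (G a) w) (L / 2 * enorm w ^+ 2).
  by have := gap _ c01; rewrite ler_norml => /andP[]; lra.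
- have [c c01] := key (- dot (G a) w) (- (L / 2 * enorm w ^+ 2)).
  by have := gap _ c01; rewrite ler_norml => /andP[]; lra.
Qed.

End Segment.

Lemma jacobian_gradient m n (S : set 'rV[R]_m) (G : 'rV[R]_m -> 'rV[R]_n) y J w :
  is_jacobian_within S G y J ->
  is_gradient_within S (fun z => dot (G z) w) y (w *m J^T).
Proof.
move=> hJ e e0; have w0 := enorm_ge0 w.
have w1 : 0 < 1 + enorm w by lra.
have e'0 : 0 < e / (1 + enorm w) by rewrite divr_gt0.
have [d [d0 H]] := hJ _ e'0; exists d; split=> // y' Sy' yd.
have h := H _ Sy' yd.
rewrite -dot_mulmx -!dotNl -!dotDl.
apply: le_trans (cauchy_schwarz _ _) _.
apply: le_trans (ler_wpM2r w0 h) _; rewrite mulrAC ler_wpM2r ?enorm_ge0 //.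
rewrite mulrAC ler_pdivrMr //; nra.
Qed.

(** * Completeness in the Euclidean norm *)

Lemma enorm_cauchy_cvg n (u : nat -> 'rV[R]_n) :
  (forall e : R, 0 < e -> exists N, forall k, (N <= k)%N -> enorm (u N - u k) < e) ->
  exists p, forall e : R, 0 < e -> exists N, forall k, (N <= k)%N -> enorm (u k - p) <= e.
Proof.
move=> cu.
have cvu i : cvg ((fun k => u k 0 i) @ \oo).
  apply/cauchy_cvgP/cauchy_exP => e e0; have [N HN] := cu e e0.
  exists (u N 0 i), N => // k /= /HN; apply: le_lt_trans.
  by have := coord_le_enorm (u N - u k) i; rewrite !mxE.
exists (\row_i lim ((fun k => u k 0 i) @ \oo)) => e e0.
(* [n.+1] keeps the denominator nonzero; [n] squares of this size sum to at most [e^2]. *)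
have e'0 : 0 < e / n.+1%:R by rewrite divr_gt0.
have [N _ HN] : \forall k \near \oo, forall i,
    `|lim ((fun k => u k 0 i) @ \oo) - u k 0 i| <= e / n.+1%:R.
  by apply: filter_forall => i; exact: cvgr_dist_le (cvu i) _ e'0.
exists N => k Nk; rewrite -(@ler_pXn2r _ 2) ?nnegrE ?enorm_ge0 ?(ltW e0) // enorm_sqr.
apply: (@le_trans _ _ (\sum_(i < n) (e / n.+1%:R) ^+ 2)).
  apply: ler_sum => i _; rewrite -expr2 -real_normK ?num_real //.
  by rewrite ler_pXn2r ?nnegrE ?(ltW e'0) // !mxE distrC HN.
rewrite sumr_const card_ord -[_ *+ n]mulr_natl expr_div_n mulrA ler_pdivrMr ?exprn_gt0 //.
rewrite mulrC ler_wpM2l ?sqr_ge0 // -natrX ler_nat; nia.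
Qed.

(** * Proximal points and the gradient of the Moreau envelope *)

(** The weight [lb] belongs to the envelope of parameter [2 * lb]. *)
Definition prox_objective n (phi : 'rV[R]_n -> R) (lb : R) (z u : 'rV[R]_n) : R :=
  phi u + lb * enorm (u - z) ^+ 2.

Section MoreauEnvelope.
Context {n : nat} (X : set 'rV[R]_n) (phi : 'rV[R]_n -> R) (proj : 'rV[R]_n -> 'rV[R]_n).
Context (lb M : R).
Hypotheses (convX : convex_set X) (projX : is_projection X proj) (lb_gt0 : 0 < lb).
Hypothesis phi_ge : forall u, X u -> M <= phi u.
Hypothesis phi_midpoint : forall a b, X a -> X b ->
  phi (a + 2^-1 *: (b - a)) <= (phi a + phi b) / 2 + lb / 8 * enorm (b - a) ^+ 2.
Hypothesis phi_lsc : forall p, X p -> forall e : R, 0 < e -> exists d : R, 0 < d /\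
  forall u, X u -> enorm (u - p) <= d -> phi p <= phi u + e.

(** A limit of points of [X] is at distance 0 from its own projection, so the existence of
    projections makes [X] closed. *)
Lemma projection_closed p :
  (forall e : R, 0 < e -> exists2 u, X u & enorm (u - p) <= e) -> X p.
Proof.
move=> hp; have [Xp pP] := projX p.
suff -> : p = proj p by [].
apply/eqP; rewrite -subr_eq0; apply/eqP/enorm0_eq0/eqP; rewrite eq_le enorm_ge0 andbT.
apply/ler_addgt0Pr => e /hp [u Xu up]; rewrite add0r.
by apply: le_trans (pP u Xu) _; rewrite enormB.
Qed.

Local Notation h := (prox_objective phi lb).

Let h_ge z u : X u -> M <= h z u.
Proof.
move=> /phi_ge phiM; rewrite /prox_objective.
have : 0 <= lb * enorm (u - z) ^+ 2 by rewrite mulr_ge0 ?sqr_ge0 ?ltW.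
lra.
Qed.

(** [phi_midpoint] is midpoint convexity of [phi + lb/2 |.|^2]. The term [lb |. - z|^2] gains
    [lb / 4] at a midpoint, which leaves [lb / 8]. *)
Let h_midpoint z a b : X a -> X b ->
  h z (a + 2^-1 *: (b - a)) <= (h z a + h z b) / 2 - lb / 8 * enorm (b - a) ^+ 2.
Proof.
move=> Xa Xb; have := phi_midpoint Xa Xb; rewrite /prox_objective.
have -> : enorm (a + 2^-1 *: (b - a) - z) ^+ 2 =
   (enorm (a - z) ^+ 2 + enorm (b - z) ^+ 2) / 2 - enorm (b - a) ^+ 2 / 4.
  rewrite !enorm_sqr.
  have -> : a + 2^-1 *: (b - a) - z = 2^-1 *: ((a - z) + (b - z)).
    by apply/rowP => i; rewrite !mxE; field.
  have -> : b - a = (b - z) - (a - z) by apply/rowP => i; rewrite !mxE; ring.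
  move: (a - z) (b - z) => p q.
  by rewrite !dotE (dotC q p); field.
lra.
Qed.

Let X_midpoint a b : X a -> X b -> X (a + 2^-1 *: (b - a)).
Proof. by move=> Xa Xb; apply: convex_set_segment => //; lra. Qed.

(** A minimising sequence is Cauchy by the midpoint gain; its limit lies in [X] by closedness and is
    a minimiser by lower semicontinuity. *)
Lemma prox_exists z : X !=set0 -> exists2 p, X p & forall u, X u -> h z p <= h z u.
Proof.
move=> [x0 Xx0]; pose E := [set h z u | u in X].
have hi : has_inf E.
  split; first by exists (h z x0), x0.
  by exists M => _ [u Xu <-]; exact: h_ge.
have ge u : X u -> inf E <= h z u by move=> Xu; apply: ge_inf; [case: hi|exists u].
have /choice [u Pu] : forall k, exists u, X u /\ h z u < inf E + k.+1%:R^-1.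
  move=> k; have k0 : 0 < k.+1%:R^-1 :> R by rewrite invr_gt0.
  by have [_ [v Xv <-] lt] := inf_adherent k0 hi; exists v.
have Nsmall (e : R) : 0 < e -> exists N, forall k, (N <= k)%N -> k.+1%:R^-1 < e.
  by move=> e0; have [N _ HN] := near_infty_natSinv_lt (PosNum e0); exists N => k /HN.
have [p pP] : exists p, forall e : R, 0 < e ->
    exists N, forall k, (N <= k)%N -> enorm (u k - p) <= e.
  apply: enorm_cauchy_cvg => e e0.
  have e'0 : 0 < e ^+ 2 * lb / 8 by rewrite divr_gt0 ?mulr_gt0 ?exprn_gt0.
  have [N HN] := Nsmall _ e'0; exists N => k Nk.
  have [XN hN] := Pu N; have [Xk hk] := Pu k.
  rewrite -(@ltr_pXn2r _ 2) ?nnegrE ?enorm_ge0 ?(ltW e0) // (enormB (u N)).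
  rewrite -(ltr_pM2r lb_gt0).
  have := h_midpoint z XN Xk; have := ge _ (X_midpoint XN Xk).
  move: (HN _ (leqnn N)) (HN _ Nk) hN hk.
  move: (N.+1%:R^-1) (k.+1%:R^-1) (inf E) => a b c; lra.
have Xp : X p.
  apply: projection_closed => e /pP[N HN]; exists (u N); last exact: HN.
  by have [] := Pu N.
exists p => // v Xv; apply: le_trans (ge _ Xv); apply/ler_addgt0Pr => e e0.
have e30 : 0 < e / 3 by lra.
have [d [d0 Hd]] := phi_lsc Xp e30.
set r := enorm (p - z); have r0 : 0 <= r := enorm_ge0 _.
(* The error [e] is split in thirds: semicontinuity, near-minimality, and the change of the
   quadratic term, at most [2 lb r |u k - p|]. The [+ 1] covers [r = 0]. *)
have c0 : 0 < 6 * lb * (r + 1) by rewrite !mulr_gt0 //; lra.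
pose d' := Num.min d (e / (6 * lb * (r + 1))).
have d'0 : 0 < d' by rewrite lt_min d0 divr_gt0.
have [N1 HN1] := pP _ d'0; have [N2 HN2] := Nsmall _ e30.
pose k := maxn N1 N2; have := HN1 k (leq_maxl _ _); have := HN2 k (leq_maxr _ _).
have [Xk hk] := Pu k; rewrite /d' le_min => k3 /andP[kd].
rewrite ler_pdivlMr // => ke.
have hphi := Hd _ Xk kd.
have tri : r <= enorm (u k - z) + enorm (u k - p).
  have := enormD (u k - z) (p - u k).
  by rewrite (enormB p (u k)) addrC addrA subrK.
have k0 := enorm_ge0 (u k - p); have kz0 := enorm_ge0 (u k - z).
have : lb * r ^+ 2 <= lb * enorm (u k - z) ^+ 2 + e / 3.
  set q := enorm (u k - p) in ke tri k0 *; set w := enorm (u k - z) in tri kz0 *.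
  have : lb * (r ^+ 2 - w ^+ 2) <= lb * (2 * r * q).
    rewrite ler_pM2l //; have [rw|wr] := lerP r w; nra.
  have : 0 <= lb * q by rewrite mulr_ge0 // ltW.
  nra.
move: hk k3; rewrite /prox_objective -/r; move: (k.+1%:R^-1) => a; lra.
Qed.

(* Only the convexity gain at the midpoint is used, whence [lb / 4] instead of [lb / 2]. *)
Lemma prox_growth z p : X p -> (forall u, X u -> h z p <= h z u) ->
  forall u, X u -> h z p + lb / 4 * enorm (u - p) ^+ 2 <= h z u.
Proof.
move=> Xp pP u Xu; have := h_midpoint z Xp Xu.
have := pP _ (X_midpoint Xp Xu); lra.
Qed.

(** A shift of [z] by [k] changes the objective by an explicit affine-quadratic amount. Testing [p]
    bounds the envelope above; quadratic growth around [p] bounds it below. *)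
Lemma moreau_gradient z p : X p -> (forall u, X u -> h z p <= h z u) ->
  is_gradient (moreau phi X (2 * lb)) z ((2 * lb) *: (z - p)).
Proof.
move=> Xp pP.
have E y : moreau phi X (2 * lb) y = inf [set h y u | u in X].
  rewrite /moreau /prox_objective; congr inf; apply: eq_imagel => u _.
  by have -> : 2 * lb / 2 = lb by field.
have shift u k : h (z + k) u = h z u - 2 * lb * dot (u - z) k + lb * enorm k ^+ 2.
  by rewrite /prox_objective opprD addrA !enorm_sqr; move: (u - z) => a; rewrite !dotE (dotC k a); ring.
have lbnd y : has_lbound [set h y u | u in X].
  by exists M => _ [u Xu <-]; exact: h_ge.
have Ez : inf [set h z u | u in X] = h z p.
  apply/eqP; rewrite eq_le; apply/andP; split; first by apply: ge_inf => //; exists p.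
  by apply: lb_le_inf => [|_ [u Xu <-]]; [exists (h z p), p|exact: pP].
have quad k : `|moreau phi X (2 * lb) (z + k) - moreau phi X (2 * lb) z -
    dot ((2 * lb) *: (z - p)) k| <= 3 * lb * enorm k ^+ 2.
  rewrite !E Ez dotZl -(opprB p z) dotNl ler_norml; apply/andP; split.
  - suff : h z p - 2 * lb * dot (p - z) k - 3 * lb * enorm k ^+ 2
        <= inf [set h (z + k) u | u in X] by lra.
    apply: lb_le_inf => [|_ [u Xu <-]]; first by exists (h (z + k) p), p.
    rewrite shift; have := prox_growth Xp pP Xu.
    have -> : u - z = (u - p) + (p - z) by rewrite addrA subrK.
    rewrite (dotDl (u - p)); have := dot_le (u - p) k.
    set a := enorm (u - p); set b := enorm k; set c := dot (u - p) k => cab.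
    have : lb * c <= lb * (a * b) by rewrite ler_pM2l.
    (* A quarter of this square absorbs the cross term [2 lb a b] into the growth [lb/4 a^2] at cost
       [4 lb b^2]; the shift returns [lb b^2], hence the constant 3. *)
    have : 0 <= lb * (a - 4 * b) ^+ 2 by rewrite mulr_ge0 ?sqr_ge0 ?ltW.
    nra.
  - have : inf [set h (z + k) u | u in X] <= h (z + k) p by apply: ge_inf => //; exists p.
    rewrite shift; have : 0 <= lb * enorm k ^+ 2 by rewrite mulr_ge0 ?sqr_ge0 ?ltW.
    lra.
move=> e e0; exists (e / (3 * lb)); split=> [|k]; first by rewrite divr_gt0 ?mulr_gt0.
rewrite ltr_pdivlMr ?mulr_gt0 // => ke; apply: le_trans (quad k) _.
rewrite expr2 mulrA ler_wpM2r ?enorm_ge0 //; lra.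
Qed.

End MoreauEnvelope.

(** * The recorded iterate and inexact projected descent *)

(** The initial record [+oo] is beaten by iteration 0, so for [T > 0] the record is an actual
    iterate. *)
Lemma alg2_best_min n (x : nat -> 'rV[R]_n) (eps : nat -> R) T : (0 < T)%N ->
  exists t, [/\ (t < T)%N, alg2_best x eps T = (x t, (eps t)%:E) &
    forall s, (s < T)%N -> eps t <= eps s].
Proof.
elim: T => // -[_ _|T /(_ isT) [t [tT bE tmin]] _].
  by exists 0%N; split=> //= [|[]//]; rewrite ltry.
have -> : alg2_best x eps T.+2 =
  if ((eps T.+1)%:E < (alg2_best x eps T.+1).2)%E then (x T.+1, (eps T.+1)%:E)
  else alg2_best x eps T.+1 by [].
rewrite bE /= lte_fin; case: ltP => [lt|ge].
- exists T.+1; split=> // s; rewrite ltnS leq_eqVlt => /predU1P[->//|/tmin].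
  exact/le_trans/ltW.
- exists t; split=> // [|s]; first exact: ltnW.
  by rewrite ltnS leq_eqVlt => /predU1P[->//|/tmin].
Qed.

(** Common core of both variants: [psi] is the function that descends, [b] the model error. The
    lower model loses [3/4 lb], less than the proximal weight [lb]; the remaining [lb / 4] controls
    the distance from the output to its proximal point. *)
Lemma projected_descent n (X : set 'rV[R]_n) (phi psi : 'rV[R]_n -> R) proj
    (lb M gam b eps : R) (T : nat) (x xt g : nat -> 'rV[R]_n) :
  let epst := fun t : nat =>
     Num.sqrt (gam ^-2 * enorm (xt t.+1 - x t) ^+ 2
               - gam ^-2 * enorm (xt t.+1 - x t.+1) ^+ 2) in
  convex_set X -> is_projection X proj ->
  0 < lb -> 0 < gam -> gam * lb <= 1 -> 0 < eps -> 0 <= b ->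
  200 * 200 * (lb * b) <= eps ^+ 2 ->
  (forall u, X u -> M <= phi u) ->
  (forall a b, X a -> X b ->
    phi (a + 2^-1 *: (b - a)) <= (phi a + phi b) / 2 + lb / 8 * enorm (b - a) ^+ 2) ->
  (forall p, X p -> forall e : R, 0 < e -> exists d : R, 0 < d /\
    forall u, X u -> enorm (u - p) <= d -> phi p <= phi u + e) ->
  (forall u, X u -> psi u <= phi u <= psi u + b) ->
  700 * (phi (x 0%N) - M) / eps ^+ 2 + 1 / lb <= T%:R * gam ->
  X (x 0%N) ->
  (forall t, (t < T)%N -> xt t.+1 = x t - gam *: g t /\ x t.+1 = proj (xt t.+1)) ->
  (forall t, (t < T)%N -> X (x t) -> X (x t.+1) ->
    psi (x t.+1) <= psi (x t) + dot (g t) (x t.+1 - x t)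
      + (2 * gam)^-1 * enorm (x t.+1 - x t) ^+ 2 + gam * (lb * b)) ->
  (forall t u, (t < T)%N -> X (x t) -> X u ->
    phi (x t) + dot (g t) (u - x t) - 3 / 4 * lb * enorm (u - x t) ^+ 2 - b <= phi u) ->
  X (alg2_best x epst T).1 /\
  exists g, is_gradient (moreau phi X (2 * lb)) (alg2_best x epst T).1 g /\ enorm g <= eps.
Proof.
move=> epst convX projX lb0 gam0 gamlb eps0 b0 b_eps phiM phi_mid phi_lsc phipsi hT X0.
move=> step desc lower.
have Xt t : (t <= T)%N -> X (x t).
  by case: t => // t /step[_ ->]; have [] := projX (xt t.+1).
have DM : 0 <= phi (x 0%N) - M by rewrite subr_ge0 phiM.
have e20 : 0 < eps ^+ 2 by rewrite exprn_gt0.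
have A0 : 0 < T%:R * gam.
  apply: lt_le_trans hT; have : 0 < 1 / lb by rewrite divr_gt0.
  have : 0 <= 700 * (phi (x 0%N) - M) / eps ^+ 2 by apply: divr_ge0; [lra|exact: ltW].
  lra.
have T0 : (0 < T)%N.
  by rewrite lt0n; apply: contraTneq A0 => ->; rewrite mul0r ltxx.
have [t [tT -> tmin]] := alg2_best_min x epst T0.
pose e2 t := gam ^-2 * enorm (xt t.+1 - x t) ^+ 2
             - gam ^-2 * enorm (xt t.+1 - x t.+1) ^+ 2.
have model s u : (s < T)%N -> gam ^-2 * enorm (xt s.+1 - x s) ^+ 2
      - gam ^-2 * enorm (xt s.+1 - u) ^+ 2 =
    - (2 / gam) * dot (g s) (u - x s) - gam ^-2 * enorm (u - x s) ^+ 2.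
  move=> /step[-> _]; rewrite !enorm_sqr.
  have -> : x s - gam *: g s - x s = - (gam *: g s) by rewrite addrAC subrr add0r.
  have -> : x s - gam *: g s - u = - (gam *: g s + (u - x s)).
    by apply/rowP => i; rewrite !mxE; ring.
  move: (u - x s) => d; rewrite !dotE (dotC d); field; lra.
(* [e2 s] is the maximum over [X] of the quadratic model, attained at the projection; [u = x s]
   gives [e2 s >= 0] next. *)
have e2_ge s u : (s < T)%N -> X u ->
    - (2 / gam) * dot (g s) (u - x s) - gam ^-2 * enorm (u - x s) ^+ 2 <= e2 s.
  move=> sT Xu; rewrite -model // lerD2l lerN2 ler_pM2l ?invr_gt0 ?exprn_gt0 //.
  rewrite ler_pXn2r ?nnegrE ?enorm_ge0 //.
  by have [_ ->] := step s sT; have [_] := projX (xt s.+1); apply.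
have e2_ge0 s : (s < T)%N -> 0 <= e2 s.
  move=> sT; have := e2_ge s (x s) sT (Xt _ (ltnW sT)).
  by rewrite subrr enorm_sqr -(scale0r 0) !dotZr !mul0r !mulr0 subr0.
have {}tmin s : (s < T)%N -> e2 t <= e2 s.
  move=> sT; rewrite -(sqr_sqrtr (e2_ge0 _ tT)) -(sqr_sqrtr (e2_ge0 _ sT)).
  by rewrite ler_pXn2r ?nnegrE ?sqrtr_ge0 // tmin.
have sum s : (s <= T)%N ->
    psi (x s) <= psi (x 0%N) - s%:R * (gam * (e2 t / 2 - lb * b)).
  elim: s => [|s IH] sT; first by rewrite mul0r subr0.
  have := IH (ltnW sT); have := desc s sT (Xt _ (ltnW sT)) (Xt _ sT).
  have := tmin s sT; have := model s (x s.+1) sT; rewrite -/(e2 s) => ->.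
  set q := dot _ _; set d2 := enorm _ ^+ 2 => tm.
  have : gam / 2 * e2 t <= - q - (2 * gam)^-1 * d2.
    have -> : - q - (2 * gam)^-1 * d2 = gam / 2 * (- (2 / gam) * q - gam ^-2 * d2).
      by field; lra.
    by rewrite ler_pM2l // divr_gt0.
  rewrite -[s.+1]addn1 natrD; lra.
have e2_small : e2 t <= eps ^+ 2 / 300.
  (* Otherwise [psi] drops by at least [A eps^2 (1/600 - 1/40000)] in total, yet by at most
     [Delta + b], while [A eps^2 >= 700 Delta + 40000 b]; the summand [1 / lb] in [hT] pays for
     [b]. *)
  rewrite leNgt; apply/negP => e2_big.
  have := sum T (leqnn T); rewrite mulrA.
  have /andP[_ psi_lo] := phipsi _ X0; have /andP[_ psi_T] := phipsi _ (Xt _ (leqnn T)).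
  have /andP[psi_up _] := phipsi _ X0.
  have MT := phiM _ (Xt _ (leqnn T)).
  set A := T%:R * gam in hT A0 *; set Delta := phi (x 0%N) - M in hT DM.
  have Ae : 700 * Delta + 200 * 200 * b <= A * eps ^+ 2.
    have := ler_wpM2r (ltW e20) hT.
    have -> : (700 * Delta / eps ^+ 2 + 1 / lb) * eps ^+ 2 = 700 * Delta + eps ^+ 2 / lb.
      by field; apply/andP; split; lra.
    have : 200 * 200 * b <= eps ^+ 2 / lb by rewrite ler_pdivlMr //; lra.
    lra.
  have : A * (eps ^+ 2 * (1 / 600 - 1 / (200 * 200))) <= A * (e2 t / 2 - lb * b).
    by rewrite ler_pM2l //; lra.
  move=> h1 h2.
  have h3 : psi (x 0%N) - psi (x T) <= Delta + b by rewrite /Delta; lra.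
  have : A * eps ^+ 2 * (1 / 600 - 1 / (200 * 200)) <= Delta + b by lra.
  (* The numerical contradiction is strict only if [Delta + b > 0]; otherwise [A eps^2 > 0] is
     contradicted. *)
  have bD : 0 < Delta + b \/ Delta + b = 0 by lra.
  case: bD => [|D0]; first by lra.
  have AE0 : A * eps ^+ 2 <= 0 by lra.
  by have := mulr_gt0 A0 e20; lra.
have Xxt := Xt _ (ltnW tT); split=> //=.
have [p Xp pP] := prox_exists convX projX lb0 phiM phi_mid phi_lsc (x t) (ex_intro _ _ X0).
exists ((2 * lb) *: (x t - p)); split; first exact: (moreau_gradient convX lb0 phiM phi_mid Xp pP).
have lb20 : 0 <= 2 * lb by lra.
rewrite -(@ler_pXn2r _ 2) ?nnegrE ?enorm_ge0 ?(ltW eps0) // enormZ ger0_norm // exprMn.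
rewrite enormB; have := pP _ Xxt; have := lower t p tT Xxt Xp.
rewrite /prox_objective subrr enorm0 expr0n mulr0 addr0.
have gl0 : 0 < gam * lb by rewrite mulr_gt0.
(* With [q <= b - lb/4 d2], the fraction [gam lb / 4] of the way to [p] optimises the test up to
   [b]: [e2 t >= lb^2 d2 / 16 - lb b / 2], so [4 lb^2 d2 <= 64 e2 t + 32 lb b <= eps^2]. *)
have s01 : 0 <= gam * lb / 4 <= 1 by lra.
have := e2_ge t _ tT (convex_set_segment convX Xxt Xp s01).
rewrite (addrC (x t)) addrK dotZr enormZ exprMn real_normK ?num_real //.
set q := dot _ _; set d2 := enorm _ ^+ 2.
have -> : - (2 / gam) * (gam * lb / 4 * q) - gam ^-2 * ((gam * lb / 4) ^+ 2 * d2) =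
   - (lb / 2 * q) - lb ^+ 2 / 16 * d2 by field; lra.
move=> h1 h2 h3.
have : lb * (lb / 4 * d2 - b + q) <= 0 by rewrite pmulr_rle0 //; lra.
lra.
Qed.

(** * The max function and its first-order bounds *)

Section MinMax.
Context {n m : nat} (X : set 'rV[R]_n) (Y : set 'rV[R]_m) (D : R).
Context (f : 'rV[R]_n -> 'rV[R]_m -> R).
Context (gx : 'rV[R]_n -> 'rV[R]_m -> 'rV[R]_n) (gy : 'rV[R]_n -> 'rV[R]_m -> 'rV[R]_m).
Context (Hxy : 'rV[R]_n -> 'rV[R]_m -> 'M[R]_(m, n)) (lambda mu rho tau : R).
Context (yhat : 'rV[R]_m).
Hypotheses (convX : convex_set X) (convY : convex_set Y) (Yyhat : Y yhat).
Hypothesis diamY : forall y1 y2, Y y1 -> Y y2 -> enorm (y1 - y2) <= D.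
Hypotheses (lambda_gt0 : 0 < lambda) (mu_ge0 : 0 <= mu) (rho_gt0 : 0 < rho).
Hypothesis tau_ge0 : 0 <= tau.
Hypothesis gx_grad : forall x y, X x -> Y y -> is_gradient_within X (f^~ y) x (gx x y).
Hypothesis gx_lip : forall x1 x2 y1 y2, X x1 -> X x2 -> Y y1 -> Y y2 ->
  enorm (gx x2 y2 - gx x1 y1) <= lambda * enorm (x2 - x1) + mu * enorm (y2 - y1).
Hypothesis gy_grad : forall x y, X x -> Y y -> is_gradient_within Y (f x) y (gy x y).
Hypothesis gy_lip : forall x y1 y2, X x -> Y y1 -> Y y2 ->
  enorm (gy x y2 - gy x y1) <= rho * enorm (y2 - y1).
Hypothesis Hxy_jac : forall x y, X x -> Y y -> is_jacobian_within Y (gx x) y (Hxy x y).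
Hypothesis Hxy_lip : forall x1 x2 y, X x1 -> X x2 -> Y y ->
  opnorm (Hxy x2 y - Hxy x1 y) <= tau * enorm (x2 - x1).

Local Notation phi := (maxfun f Y).
Local Notation lb := (lambda + 2 * tau * D).

Lemma diam_ge0 : 0 <= D.
Proof. by have := diamY Yyhat Yyhat; rewrite subrr enorm0. Qed.

Lemma lb_ge_lambda : lambda <= lb.
Proof. by rewrite lerDl !mulr_ge0 // diam_ge0. Qed.

Lemma f_smooth_x x1 x2 y : X x1 -> X x2 -> Y y ->
  `|f x2 y - f x1 y - dot (gx x1 y) (x2 - x1)| <= lambda / 2 * enorm (x2 - x1) ^+ 2.
Proof.
move=> X1 X2 Yy; apply: (smooth_quadratic_bound convX (F := f^~ y) (G := gx^~ y)) => //.
  by move=> z Xz; exact: gx_grad.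
move=> z Xz; have := gx_lip X1 Xz Yy Yy.
by rewrite subrr enorm0 mulr0 addr0.
Qed.

Lemma f_smooth_y x y1 y2 : X x -> Y y1 -> Y y2 ->
  `|f x y2 - f x y1 - dot (gy x y1) (y2 - y1)| <= rho / 2 * enorm (y2 - y1) ^+ 2.
Proof.
move=> Xx Y1 Y2; apply: (smooth_quadratic_bound convY (F := f x) (G := gy x)) => //.
  by move=> z Yz; exact: gy_grad.
by move=> z Yz; exact: gy_lip.
Qed.

(** The [sup] is finite because the quadratic upper bound at [yhat] is bounded over the diameter of
    [Y]. *)
Lemma le_maxfun x y : X x -> Y y -> f x y <= phi x.
Proof.
move=> Xx Yy; apply: ub_le_sup; last by exists y.
exists (f x yhat + enorm (gy x yhat) * D + rho / 2 * D ^+ 2) => _ [z Yz <-].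
have := f_smooth_y Xx Yyhat Yz; rewrite ler_norml => /andP[_].
have := dot_le (gy x yhat) (z - yhat).
have : enorm (gy x yhat) * enorm (z - yhat) <= enorm (gy x yhat) * D.
  by rewrite ler_wpM2l ?enorm_ge0 // diamY.
have : rho / 2 * enorm (z - yhat) ^+ 2 <= rho / 2 * D ^+ 2.
  rewrite ler_pM2l ?divr_gt0 // ler_pXn2r ?nnegrE ?enorm_ge0 ?diam_ge0 //.
  exact: diamY.
lra.
Qed.

Lemma maxfun_le x C : (forall y, Y y -> f x y <= C) -> phi x <= C.
Proof.
by move=> h; apply: ge_sup => [|_ [y Yy <-]]; [exists (f x yhat), yhat|exact: h].
Qed.

(** Expanding each [f^~ y] at the midpoint cancels the gradient terms; the resulting weak convexity
    survives the supremum. *)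
Lemma maxfun_midpoint a b : X a -> X b ->
  phi (a + 2^-1 *: (b - a)) <= (phi a + phi b) / 2 + lb / 8 * enorm (b - a) ^+ 2.
Proof.
move=> Xa Xb; set z := a + _.
have Xz : X z by apply: convex_set_segment => //; lra.
apply: maxfun_le => y Yy.
have := f_smooth_x Xz Xa Yy; have := f_smooth_x Xz Xb Yy.
have -> : a - z = - (2^-1 *: (b - a)) by rewrite /z opprD addrA subrr sub0r.
have -> : b - z = 2^-1 *: (b - a) by apply/rowP => i; rewrite !mxE; field.
rewrite enormN enormZ dotNr exprMn (@gtr0_norm _ 2^-1) ?invr_gt0 //.
rewrite !ler_norml => /andP[hb _] /andP[ha _].
move: ha hb.
have := le_maxfun Xa Yy; have := le_maxfun Xb Yy.
have : lambda * enorm (b - a) ^+ 2 <= lb * enorm (b - a) ^+ 2.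
  by rewrite ler_wpM2r ?sqr_ge0 ?lb_ge_lambda.
lra.
Qed.

(** Replacing [gx x y] by [gx x y0] costs [mu * D * r] uniformly in [y], so the bound passes to the
    supremum both ways. *)
Lemma maxfun_linear_bound x u y0 : X x -> X u -> Y y0 ->
  `|phi u - phi x - dot (gx x y0) (u - x)| <=
  mu * D * enorm (u - x) + lambda / 2 * enorm (u - x) ^+ 2.
Proof.
move=> Xx Xu Y0; set r := enorm (u - x).
have bound y : Y y -> `|f u y - f x y - dot (gx x y0) (u - x)| <=
    mu * D * r + lambda / 2 * r ^+ 2.
  move=> Yy; have := f_smooth_x Xx Xu Yy.
  have : `|dot (gx x y - gx x y0) (u - x)| <= mu * D * r.
    apply: le_trans (cauchy_schwarz _ _) _; rewrite ler_wpM2r ?enorm_ge0 //.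
    have := gx_lip Xx Xx Y0 Yy; rewrite subrr enorm0 mulr0 add0r => /le_trans; apply.
    by rewrite ler_wpM2l // diamY.
  rewrite dotDl dotNl => h1 h2.
  have -> : f u y - f x y - dot (gx x y0) (u - x) =
    (dot (gx x y) (u - x) - dot (gx x y0) (u - x)) +
    (f u y - f x y - dot (gx x y) (u - x)) by ring.
  by apply: le_trans (ler_normD _ _) _; exact: lerD.
rewrite ler_norml; apply/andP; split.
- suff : phi x <= phi u - dot (gx x y0) (u - x) + (mu * D * r + lambda / 2 * r ^+ 2) by lra.
  apply: maxfun_le => y Yy; have := bound y Yy; rewrite ler_norml => /andP[+ _].
  have := le_maxfun Xu Yy; lra.
- suff : phi u <= phi x + dot (gx x y0) (u - x) + (mu * D * r + lambda / 2 * r ^+ 2) by lra.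
  apply: maxfun_le => y Yy; have := bound y Yy; rewrite ler_norml => /andP[_].
  have := le_maxfun Xx Yy; lra.
Qed.

Lemma maxfun_lsc p : X p -> forall e : R, 0 < e -> exists d : R, 0 < d /\
  forall u, X u -> enorm (u - p) <= d -> phi p <= phi u + e.
Proof.
move=> Xp e e0; set K := enorm (gx p yhat) + mu * D + lambda / 2.
have G0 := enorm_ge0 (gx p yhat).
have muD : 0 <= mu * D by rewrite mulr_ge0 // diam_ge0.
have K0 : 0 < K by rewrite ltr_wpDl ?addr_ge0 ?divr_gt0.
exists (Num.min 1 (e / K)); split; first by rewrite lt_min ltr01 divr_gt0.
move=> u Xu; rewrite le_min ler_pdivlMr // => /andP[r1 rK].
have := maxfun_linear_bound Xp Xu Yyhat; rewrite ler_norml => /andP[+ _].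
have := cauchy_schwarz (gx p yhat) (u - p); rewrite ler_norml => /andP[+ _].
set r := enorm (u - p) in r1 rK *; have r0 : 0 <= r := enorm_ge0 _.
have : r ^+ 2 <= r by nra.
move=> /(ler_wpM2l (ltW lambda_gt0)); rewrite /K in rK; lra.
Qed.

(** * Mixed second differences *)

(** The mean value theorem is applied to the difference of both gradients at once, so that the two
    matrices are taken at the same [z c] and [Hxy_lip] applies. *)
Lemma mixed_difference_bound x1 x2 a b w : X x1 -> X x2 -> Y a -> Y b ->
  `|dot (gx x2 b) w - dot (gx x2 a) w - (dot (gx x1 b) w - dot (gx x1 a) w)| <=
  tau * enorm (x2 - x1) * enorm (b - a) * enorm w.
Proof.
move=> X1 X2 Ya Yb; pose z s := a + s *: (b - a).
have Yz s : 0 <= s <= 1 -> Y (z s) by move=> /(convex_set_segment convY Ya Yb).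
have [s s01|c c01] := derive_within01_mvt
    (k := fun s => dot (gx x2 (z s)) w + - dot (gx x1 (z s)) w)
    (k' := fun s => dot (w *m (Hxy x2 (z s))^T) (b - a) + - dot (w *m (Hxy x1 (z s))^T) (b - a)).
  apply: derive_within01D; last apply: derive_within01N.
    apply: (derive_within01_segment convY (F := fun y => dot (gx x2 y) w)) => //.
    by apply: jacobian_gradient; apply: Hxy_jac => //; exact: Yz.
  apply: (derive_within01_segment convY (F := fun y => dot (gx x1 y) w)) => //.
  by apply: jacobian_gradient; apply: Hxy_jac => //; exact: Yz.
have -> : z 1 = b by rewrite /z scale1r addrC subrK.
have -> : z 0 = a by rewrite /z scale0r addr0.
move=> e.
have -> : dot (gx x2 b) w - dot (gx x2 a) w - (dot (gx x1 b) w - dot (gx x1 a) w) =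
  dot ((b - a) *m (Hxy x2 (z c) - Hxy x1 (z c))) w.
  by rewrite mulmxBr dotDl dotNl (dot_mulmx _ (Hxy x2 _)) (dot_mulmx _ (Hxy x1 _)) -e; ring.
apply: le_trans (cauchy_schwarz _ _) _; rewrite ler_wpM2r ?enorm_ge0 //.
apply: le_trans (enorm_mulmx_opnorm _ _) _; rewrite ler_wpM2r ?enorm_ge0 //.
by apply: Hxy_lip => //; exact: Yz.
Qed.

(* Symmetry of second derivatives in quantitative form: the x-derivative of
   [gy x yhat] in the direction [y - yhat] is the y-derivative [Hxy] of [gx],
   because the mixed second difference of [f] can be evaluated in either order. *)
Lemma gy_smooth_x x1 x2 y : X x1 -> X x2 -> Y y ->
  `|dot (gy x2 yhat) (y - yhat) - dot (gy x1 yhat) (y - yhat)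
    - dot ((y - yhat) *m Hxy x1 yhat) (x2 - x1)| <=
  tau * enorm (y - yhat) * enorm (x2 - x1) ^+ 2.
Proof.
move=> X1 X2 Yy; set v := y - yhat; set w := x2 - x1.
pose z h := yhat + h *: v.
have Yz h : 0 <= h <= 1 -> Y (z h) by move=> /(convex_set_segment convY Yyhat Yy).
have z0 : z 0 = yhat by rewrite /z scale0r addr0.
have at0 : yhat + 0 *: (y - yhat) = yhat by rewrite scale0r addr0.
rewrite dot_mulmx.
(* The quantity to bound is the derivative of this [k] at 0. *)
apply: (derive_within01_norm_le
  (k := fun h => f x2 (z h) + - f x1 (z h) + - dot (gx x1 (z h)) w)).
  apply: derive_within01D; last first.
    apply/derive_within01N/(derive_within01_segment convY (F := fun y => dot (gx x1 y) w)) => //.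
    by rewrite at0; apply: jacobian_gradient; exact: Hxy_jac.
  apply: derive_within01D; last apply: derive_within01N.
    by apply: (derive_within01_segment convY) => //; rewrite at0; exact: gy_grad.
  by apply: (derive_within01_segment convY) => //; rewrite at0; exact: gy_grad.
move=> h /andP[h0 h1]; have Yh : Y (z h) by apply: Yz; rewrite h1 ltW.
pose xs s := x1 + s *: w.
have Xs s : 0 <= s <= 1 -> X (xs s) by move=> /(convex_set_segment convX X1 X2).
(* Read in the [x] direction, the same increment is a mixed difference of [gx] between [x1] and
   [xs c]. *)
have [s s01|c c01] := derive_within01_mvt
    (k := fun s => f (xs s) (z h) + - f (xs s) yhat)
    (k' := fun s => dot (gx (xs s) (z h)) w + - dot (gx (xs s) yhat) w).
  apply: derive_within01D; last apply: derive_within01N.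
    apply: (derive_within01_segment convX (F := f^~ (z h))) => //.
    by apply: gx_grad => //; exact: Xs.
  apply: (derive_within01_segment convX (F := f^~ yhat)) => //.
  by apply: gx_grad => //; exact: Xs.
have -> : xs 1 = x2 by rewrite /xs scale1r addrC subrK.
have -> : xs 0 = x1 by rewrite /xs scale0r addr0.
rewrite z0 => e.
have := mixed_difference_bound w X1 (Xs _ c01) Yyhat Yh.
have -> : f x2 (z h) + - f x1 (z h) + - dot (gx x1 (z h)) w -
   (f x2 yhat + - f x1 yhat + - dot (gx x1 yhat) w) =
   dot (gx (xs c) (z h)) w - dot (gx (xs c) yhat) w -
   (dot (gx x1 (z h)) w - dot (gx x1 yhat) w) by rewrite -e; ring.
move/le_trans; apply.
rewrite /xs /z (addrC x1) (addrC yhat) !addrK !enormZ (gtr0_norm h0).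
case/andP: c01 => c0 c1; rewrite (ger0_norm c0).
have : 0 <= h * (tau * enorm v * enorm w ^+ 2).
  by rewrite !mulr_ge0 ?enorm_ge0 ?exprn_ge0 ?enorm_ge0 // ltW.
set q := h * _ => q0.
have -> : tau * (c * enorm w) * (h * enorm v) * enorm w = c * q by rewrite /q; ring.
by rewrite ler_piMl.
Qed.

(** [yhat + h (y2 - y1)] may leave [Y], so derivatives towards [y2] and [y1] are subtracted; the two
    moving points are [h |y2 - y1|] apart. *)
Lemma Hxy_bound x y1 y2 w : X x -> Y y1 -> Y y2 ->
  `|dot ((y2 - y1) *m Hxy x yhat) w| <= mu * enorm (y2 - y1) * enorm w.
Proof.
move=> Xx Y1 Y2; pose z y h := yhat + h *: (y - yhat).
have Yz y h : Y y -> 0 <= h <= 1 -> Y (z y h).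
  by move=> Yy; exact: convex_set_segment.
have z0 y : z y 0 = yhat by rewrite /z scale0r addr0.
have -> : y2 - y1 = (y2 - yhat) - (y1 - yhat) by rewrite opprB addrA subrK.
rewrite {1}mulmxBl dotDl dotNl (dot_mulmx (y2 - _)) (dot_mulmx (y1 - _)).
apply: (derive_within01_norm_le
  (k := fun h => dot (gx x (z y2 h)) w + - dot (gx x (z y1 h)) w)).
  apply: derive_within01D; last apply: derive_within01N.
    apply: (derive_within01_segment convY (F := fun y => dot (gx x y) w)) => //.
    by rewrite -/(z y2 0) z0; apply: jacobian_gradient; exact: Hxy_jac.
  apply: (derive_within01_segment convY (F := fun y => dot (gx x y) w)) => //.
  by rewrite -/(z y1 0) z0; apply: jacobian_gradient; exact: Hxy_jac.
move=> h /andP[h0 h1]; have h01 : 0 <= h <= 1 by rewrite h1 ltW.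
rewrite !z0 subrr subr0 -dotNl -dotDl.
apply: le_trans (cauchy_schwarz _ _) _; rewrite !mulrA ler_wpM2r ?enorm_ge0 //.
have := gx_lip Xx Xx (Yz _ _ Y1 h01) (Yz _ _ Y2 h01).
rewrite subrr enorm0 mulr0 add0r.
have -> : z y2 h - z y1 h = h *: (y2 - yhat - (y1 - yhat)).
  by apply/rowP => i; rewrite !mxE; ring.
by rewrite enormZ (gtr0_norm h0) mulrCA mulrA.
Qed.

(** * The smooth surrogate behind the coupled step *)

Section CoupledStep.
Context (projY : 'rV[R]_m -> 'rV[R]_m).
Hypothesis projYP : is_projection Y projY.

(* The proximal surrogate of [f x]: its maximiser over [Y] is [coupled_y x], and
   by [rho]-strong concavity its maximum is smooth in [x], with gradient [coupled_gx x]. *)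
Definition regularized x y : R :=
  f x yhat + dot (gy x yhat) (y - yhat) - rho / 2 * enorm (y - yhat) ^+ 2.

Definition coupled_y x : 'rV[R]_m := projY (yhat + (1 / rho) *: gy x yhat).

Definition coupled_gx x : 'rV[R]_n :=
  gx x yhat + (coupled_y x - yhat) *m Hxy x yhat.

Local Notation psi := (fun x => regularized x (coupled_y x)).

Lemma coupled_yP x : Y (coupled_y x).
Proof. by have [] := projYP (yhat + (1 / rho) *: gy x yhat). Qed.

(** Completing the square is exact: besides [rho/2 |y - q|^2] it leaves an inner product whose sign
    the projection fixes. *)
Lemma regularized_growth x y : Y y ->
  regularized x y + rho / 2 * enorm (y - coupled_y x) ^+ 2 <= psi x.
Proof.
move=> Yy; have := projection_obtuse (yhat + (1 / rho) *: gy x yhat) convY projYP Yy.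
rewrite -/(coupled_y x); set q := coupled_y x; set g := gy x yhat => h.
have -> : psi x = regularized x y + rho / 2 * enorm (y - q) ^+ 2
    - rho * dot (yhat + (1 / rho) *: g - q) (y - q).
  rewrite /= /regularized -/q -/g.
  have -> : y - yhat = (y - q) + (q - yhat) by rewrite addrA subrK.
  have -> : yhat + (1 / rho) *: g - q = (1 / rho) *: g - (q - yhat).
    by apply/rowP => i; rewrite !mxE; ring.
  move: (y - q) (q - yhat) => a b.
  by rewrite !enorm_sqr !dotE (dotC b a); field; exact: lt0r_neq0.
by rewrite lerDl -mulrN pmulr_rge0 // oppr_ge0.
Qed.

Lemma regularized_approx x y : X x -> Y y ->
  regularized x y <= f x y <= regularized x y + rho * D ^+ 2.
Proof.
move=> Xx Yy; have := f_smooth_y Xx Yyhat Yy; rewrite ler_norml => /andP[lo up].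
have : rho * enorm (y - yhat) ^+ 2 <= rho * D ^+ 2.
  by rewrite ler_pM2l // ler_pXn2r ?nnegrE ?enorm_ge0 ?diam_ge0 ?diamY.
rewrite /regularized => h; apply/andP; split; lra.
Qed.

Lemma regularized_maxfun x : X x -> psi x <= phi x <= psi x + rho * D ^+ 2.
Proof.
move=> Xx; apply/andP; split.
  apply: le_trans (le_maxfun Xx (coupled_yP x)).
  by have /andP[] := regularized_approx Xx (coupled_yP x).
apply: maxfun_le => y Yy; have /andP[_] := regularized_approx Xx Yy.
have := regularized_growth x Yy.
have : 0 <= rho / 2 * enorm (y - coupled_y x) ^+ 2.
  by rewrite mulr_ge0 ?sqr_ge0 ?divr_ge0 ?(ltW rho_gt0).
rewrite /=; lra.
Qed.

(** [f^~ yhat] contributes [lambda / 2] and the linear term in [gy] contributes [tau * D]: together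
    [lb / 2]. *)
Lemma regularized_smooth_x x1 x2 y : X x1 -> X x2 -> Y y ->
  `|regularized x2 y - regularized x1 y
    - dot (gx x1 yhat + (y - yhat) *m Hxy x1 yhat) (x2 - x1)| <=
  lb / 2 * enorm (x2 - x1) ^+ 2.
Proof.
move=> X1 X2 Yy; have := f_smooth_x X1 X2 Yyhat; have := gy_smooth_x X1 X2 Yy.
have : tau * enorm (y - yhat) * enorm (x2 - x1) ^+ 2 <= tau * D * enorm (x2 - x1) ^+ 2.
  by rewrite ler_wpM2r ?sqr_ge0 // ler_wpM2l // diamY.
rewrite /regularized (dotDl (gx x1 yhat)) !ler_norml => h /andP[? ?] /andP[? ?].
apply/andP; split; lra.
Qed.

(** The maximiser for [x] is a competitor at [u]. *)
Lemma regularized_max_lower x u : X x -> X u ->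
  psi x + dot (coupled_gx x) (u - x) - lb / 2 * enorm (u - x) ^+ 2 <= psi u.
Proof.
move=> Xx Xu; have := regularized_smooth_x Xx Xu (coupled_yP x).
rewrite ler_norml => /andP[+ _]; have := regularized_growth u (coupled_yP x).
have : 0 <= rho / 2 * enorm (coupled_y x - coupled_y u) ^+ 2.
  by rewrite mulr_ge0 ?sqr_ge0 ?divr_ge0 ?(ltW rho_gt0).
rewrite /coupled_gx /=; lra.
Qed.

(** Using the maximiser for [u] costs [mu a r] through [Hxy]; the growth [rho/2 a^2] absorbs it by
    Young's inequality, leaving [mu^2 / (2 rho) r^2]. *)
Lemma regularized_max_upper x u : X x -> X u ->
  psi u <= psi x + dot (coupled_gx x) (u - x) + (lb + mu ^+ 2 / rho) / 2 * enorm (u - x) ^+ 2.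
Proof.
move=> Xx Xu; have Yu := coupled_yP u; have Yx := coupled_yP x.
have := regularized_smooth_x Xx Xu Yu; rewrite ler_norml => /andP[_].
have := regularized_growth x Yu.
have := Hxy_bound (u - x) Xx Yx Yu; rewrite ler_norml => /andP[_].
rewrite /coupled_gx /=.
have -> : coupled_y u - yhat = (coupled_y u - coupled_y x) + (coupled_y x - yhat).
  by rewrite addrA subrK.
rewrite (mulmxDl (coupled_y u - coupled_y x)).
move: ((coupled_y u - _) *m _) ((coupled_y x - _) *m _) => A B; rewrite !dotDl.
set a := enorm (coupled_y u - _); set r := enorm (u - x).
have : 0 <= rho / 2 * (a - mu / rho * r) ^+ 2.
  by rewrite mulr_ge0 ?sqr_ge0 ?divr_ge0 ?(ltW rho_gt0).
have -> : rho / 2 * (a - mu / rho * r) ^+ 2 =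
    rho / 2 * a ^+ 2 - mu * a * r + mu ^+ 2 / rho / 2 * r ^+ 2 by field; exact: lt0r_neq0.
lra.
Qed.

End CoupledStep.

End MinMax.

End EuclideanGeometry.

(** * Both variants as instances of inexact projected descent *)

Theorem theorem3 (R : realType) (n m : nat)
  (X : set 'rV[R]_n) (Y : set 'rV[R]_m) (D : R)
  (f : 'rV[R]_n -> 'rV[R]_m -> R)
  (gx : 'rV[R]_n -> 'rV[R]_m -> 'rV[R]_n)
  (gy : 'rV[R]_n -> 'rV[R]_m -> 'rV[R]_m)
  (Hxy : 'rV[R]_n -> 'rV[R]_m -> 'M[R]_(m, n))
  (lambda mu rho1 sigma1 tau1 eps : R)
  (projX : 'rV[R]_n -> 'rV[R]_n) (projY : 'rV[R]_m -> 'rV[R]_m)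
  (x0 : 'rV[R]_n) (yhat : 'rV[R]_m) (T : nat)
  (x xt : nat -> 'rV[R]_n) (y : nat -> 'rV[R]_m) :
  (* the sets *)
  convex_set X -> interior X !=set0 ->
  convex_set Y -> interior Y !=set0 -> compact Y ->
  (forall y1 y2, Y y1 -> Y y2 -> enorm (y1 - y2) <= D) ->
  (* constants *)
  0 < lambda -> 0 <= mu -> 0 < rho1 -> 0 <= tau1 -> 0 < eps ->
  (* (A1) *)
  (forall x1 y1, X x1 -> Y y1 -> is_gradient_within X (f^~ y1) x1 (gx x1 y1)) ->
  (forall x1 x2 y1 y2, X x1 -> X x2 -> Y y1 -> Y y2 ->
     enorm (gx x2 y2 - gx x1 y1) <= lambda * enorm (x2 - x1) + mu * enorm (y2 - y1)) ->
  (* (A2), k = 1 *)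
  (forall x1 y1, X x1 -> Y y1 -> is_gradient_within Y (f x1) y1 (gy x1 y1)) ->
  (forall x1 x2 y1 y2, X x1 -> X x2 -> Y y1 -> Y y2 ->
     enorm (gy x2 y2 - gy x1 y1) <= rho1 * enorm (y2 - y1) + sigma1 * enorm (x2 - x1)) ->
  (* (A3), k = 1 *)
  (forall x1 y1, X x1 -> Y y1 -> is_jacobian_within Y (gx x1) y1 (Hxy x1 y1)) ->
  (forall x1 x2 y1, X x1 -> X x2 -> Y y1 ->
     opnorm (Hxy x2 y1 - Hxy x1 y1) <= tau1 * enorm (x2 - x1)) ->
  (* (A4), k = 1 *)
  lebesgue_measurable_set
    [set z : 'rV[R]_(n + m) | exists x1 y1, z = row_mx x1 y1 /\ X x1 /\ Y y1 /\
       ~ (exists L : 'I_n -> 'M[R]_(m, n),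
            is_mx_derivative_within X (Hxy^~ y1) x1 L)] ->
  (* accuracy condition *)
  let lb := lambda + 2 * tau1 * D in
  200 * Num.min mu (Num.sqrt (lb * rho1)) * D <= eps ->
  (* Algorithm 2 with the prescribed parameters *)
  is_projection X projX -> is_projection Y projY ->
  X x0 -> Y yhat ->
  let gamx := 1 / (3 * lb + mu ^+ 2 / rho1) in
  let coupled := Num.sqrt (lb * rho1) <= mu in
  let gamy := 1 / rho1 in
  let phi := maxfun f Y in
  let Delta := ((phi x0)%:E - ereal_inf [set (phi u)%:E | u in X])%E in
  ((3 + mu ^+ 2 / (lb * rho1))%:E * ((700 * lb / eps ^+ 2)%:E * Delta + 1%:E)
     <= (T%:R)%:E)%E ->
  x 0%N = x0 ->
  (forall t, (t < T)%N ->
     (if coupled then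
        y t = projY (yhat + gamy *: gy (x t) yhat) /\
        xt t.+1 = x t - gamx *: (gx (x t) yhat + (y t - yhat) *m Hxy (x t) yhat)
      else
        (Y (y t) /\ forall y1, Y y1 -> dot (gy (x t) yhat) y1 <= dot (gy (x t) yhat) (y t)) /\
        xt t.+1 = x t - gamx *: gx (x t) (y t)) /\
     x t.+1 = projX (xt t.+1)) ->
  let epst := fun t : nat =>
     Num.sqrt (gamx ^-2 * enorm (xt t.+1 - x t) ^+ 2
               - gamx ^-2 * enorm (xt t.+1 - x t.+1) ^+ 2) in
  let xstar := (alg2_best x epst T).1 in
  X xstar /\
  exists g, is_gradient (moreau phi X (2 * lb)) xstar g /\ enorm g <= eps.
Proof.
move=> convX _ convY _ _ diamY lambda0 mu0 rho0 tau0 eps0 gx_grad gx_lip gy_grad gy_lip.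
move=> Hjac Hlip _ lb acc projXP projYP X0 Yyhat gamx coupled gamy phi Delta hT x0E step.
move=> epst xstar.
have {}gy_lip x1 y1 y2 : X x1 -> Y y1 -> Y y2 ->
    enorm (gy x1 y2 - gy x1 y1) <= rho1 * enorm (y2 - y1).
  move=> X1 Y1 Y2; have := gy_lip x1 x1 y1 y2 X1 X1 Y1 Y2.
  by rewrite (subrr x1) enorm0 mulr0 addr0.
have D0 : 0 <= D := diam_ge0 Yyhat diamY.
have lb_lambda : lambda <= lb := lb_ge_lambda lambda Yyhat diamY tau0.
have lb0 : 0 < lb := lt_le_trans lambda0 lb_lambda.
have phi_mid := maxfun_midpoint convX convY Yyhat diamY rho0 tau0 gx_grad gx_lip gy_grad gy_lip.
have phi_lsc := maxfun_lsc convX convY Yyhat diamY lambda0 mu0 rho0 gx_grad gx_lip gy_grad gy_lip.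
have phi_lin := maxfun_linear_bound convX convY Yyhat diamY mu0 rho0 gx_grad gx_lip gy_grad gy_lip.
have psi_phi := regularized_maxfun convY Yyhat diamY rho0 gy_grad gy_lip projYP.
have psi_lo := regularized_max_lower convX convY Yyhat diamY rho0 tau0
  gx_grad gx_lip gy_grad Hjac Hlip projYP.
have psi_up := regularized_max_upper convX convY Yyhat diamY rho0 tau0
  gx_grad gx_lip gy_grad Hjac Hlip projYP.
rewrite -/lb -/phi in phi_mid phi_lsc phi_lin psi_phi psi_lo psi_up.
have mr0 : 0 <= mu ^+ 2 / rho1 by rewrite divr_ge0 ?sqr_ge0 // ltW.
pose i := 3 * lb + mu ^+ 2 / rho1.
have i0 : 0 < i by rewrite /i; lra.
have gam0 : 0 < gamx by rewrite divr_gt0.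
have gami : gamx * i = 1 by rewrite /gamx -/i mul1r mulVf // lt0r_neq0.
have gamV : (2 * gamx)^-1 = i / 2 by rewrite /gamx -/i mul1r invfM invrK mulrC.
have gamlb : gamx * lb <= 1.
  have : gamx * lb <= gamx * i by rewrite ler_pM2l // /i; lra.
  lra.
have [M phiM hTM] : exists2 M, forall u, X u -> M <= phi u &
    700 * (phi (x 0%N) - M) / eps ^+ 2 + 1 / lb <= T%:R * gamx.
  have inf_le u : X u -> (ereal_inf [set (phi u)%:E | u in X] <= (phi u)%:E)%E.
    by move=> Xu; apply: ereal_inf_lbound; exists u.
  have c0 : 0 < 3 + mu ^+ 2 / (lb * rho1).
    by have : 0 <= mu ^+ 2 / (lb * rho1); [rewrite divr_ge0 ?sqr_ge0 ?mulr_ge0 // ltW|lra].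
  have c1 : 0 < 700 * lb / eps ^+ 2 by apply: divr_gt0; [lra|exact: exprn_gt0].
  (* The infimum is not [+oo] because of [x0]; [-oo] would make [Delta] infinite and [hT] false. *)
  move: hT; rewrite /Delta; case: (ereal_inf _) inf_le => [M|/(_ _ X0)//|_].
    move=> phiM hTE.
    have {hTE} hT : (3 + mu ^+ 2 / (lb * rho1)) *
      (700 * lb / eps ^+ 2 * (phi x0 - M) + 1) <= T%:R by rewrite -lee_fin; exact: hTE.
    exists M => [u Xu|]; first by rewrite -lee_fin phiM.
    rewrite x0E; apply: le_trans (ler_wpM2r (ltW gam0) hT).
    have -> : 3 + mu ^+ 2 / (lb * rho1) = i / lb.
      by rewrite /i; field; rewrite !lt0r_neq0.
    move: (phi x0 - M) => De.
    have -> : i / lb * (700 * lb / eps ^+ 2 * De + 1) * gamx =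
      gamx * i * (700 * De / eps ^+ 2 + 1 / lb) by field; rewrite !lt0r_neq0.
    by rewrite gami [leRHS]mul1r lexx.
  by rewrite /= gt0_muley ?lte_fin // gt0_muley ?lte_fin.
rewrite -x0E in X0.
have acc_sqr a : 0 <= a -> 200 * a * D <= eps -> 200 * 200 * (a * D) ^+ 2 <= eps ^+ 2.
  move=> a0 h; have aD : 0 <= 200 * a * D by rewrite !mulr_ge0.
  by have := ler_pM aD aD h h; lra.
have [cp|ncp] := boolP (Num.sqrt (lb * rho1) <= mu).
- rewrite min_r // in acc.
  (* Here [lb * b] is the square of [sqrt (lb rho1) * D], which the accuracy condition controls. *)
  apply: (projected_descent (M := M) (b := rho1 * D ^+ 2)
    (g := fun t => coupled_gx gx gy Hxy rho1 yhat projY (x t))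
    (psi := fun x => regularized f gy rho1 yhat x (coupled_y gy rho1 yhat projY x))) => //.
  + by rewrite mulr_ge0 ?sqr_ge0 // ltW.
  + have lr0 : 0 <= lb * rho1 by rewrite mulr_ge0 // ltW.
    have E : (Num.sqrt (lb * rho1) * D) ^+ 2 = lb * (rho1 * D ^+ 2).
      by rewrite exprMn (sqr_sqrtr lr0) mulrA.
    by rewrite -E; exact: acc_sqr.
  + move=> t tT; have := step t tT; rewrite /coupled cp => -[[yE xtE] xE].
    by split=> //; rewrite xtE yE.
  + move=> t tT Xt Xt1; have := psi_up _ _ Xt Xt1; rewrite gamV /i /=.
    have : 0 <= lb * enorm (x t.+1 - x t) ^+ 2 by rewrite mulr_ge0 ?sqr_ge0 // ltW.
    have : 0 <= gamx * (lb * (rho1 * D ^+ 2)).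
      exact: mulr_ge0 (ltW gam0) (mulr_ge0 (ltW lb0) (mulr_ge0 (ltW rho0) (sqr_ge0 D))).
    move: (enorm _ ^+ 2) (gamx * _) => r2 c; lra.
  + move=> t u tT Xt Xu; have := psi_lo _ _ Xt Xu.
    have /andP[_] := psi_phi _ Xt; have /andP[+ _] := psi_phi _ Xu.
    have : 0 <= lb * enorm (u - x t) ^+ 2 by rewrite mulr_ge0 ?sqr_ge0 // ltW.
    rewrite /=; move: (enorm _ ^+ 2) => r2; lra.
- have := ncp; rewrite -ltNge => /ltW lt_mu; rewrite min_l // in acc.
  have lbb : lb * ((mu * D) ^+ 2 / lb) = (mu * D) ^+ 2 by field; exact: lt0r_neq0.
  have stepY t : (t < T)%N -> Y (y t).
    by move=> tT; have := step t tT; rewrite /coupled (negbTE ncp) => -[[[]]].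
  (* With [psi = phi], [b] only accounts for the gradient error: [lb * b = (mu D)^2]. *)
  apply: (projected_descent (M := M) (b := (mu * D) ^+ 2 / lb)
    (g := fun t => gx (x t) (y t)) (psi := phi)) => //.
  + by rewrite divr_ge0 ?sqr_ge0 // ltW.
  + by rewrite lbb acc_sqr.
  + by move=> u Xu; rewrite lexx lerDl divr_ge0 ?sqr_ge0 // ltW.
  + by move=> t tT; have := step t tT; rewrite /coupled (negbTE ncp) => -[[_ ->] ->].
  + move=> t tT Xt Xt1; have := phi_lin _ _ _ Xt Xt1 (stepY t tT).
    rewrite gamV lbb ler_norml => /andP[_].
    set r := enorm _; have r20 : 0 <= r ^+ 2 := sqr_ge0 r.
    (* Young: [mu D r <= gamx (mu D)^2 + i/4 r^2], and [lambda / 2 <= i / 6] fits in the remaining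
       [i / 4]. *)
    have : 0 <= gamx * (mu * D - i / 2 * r) ^+ 2 by rewrite mulr_ge0 ?sqr_ge0 // ltW.
    have -> : gamx * (mu * D - i / 2 * r) ^+ 2 = gamx * (mu * D) ^+ 2
      - gamx * i * (mu * D * r) + gamx * i * (i / 4 * r ^+ 2) by field.
    have : lambda * r ^+ 2 <= lb * r ^+ 2 by rewrite ler_wpM2r.
    have : lb * r ^+ 2 <= i / 3 * r ^+ 2 by rewrite ler_wpM2r // /i; lra.
    have : 0 <= lb * r ^+ 2 by rewrite mulr_ge0 // ltW.
    rewrite gami !mul1r; move: (gamx * _) (mu * D * r) => c d; clearbody i; nra.
  + move=> t u tT Xt Xu; have := phi_lin _ _ _ Xt Xu (stepY t tT).
    rewrite ler_norml => /andP[+ _].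
    set r := enorm _; have r20 : 0 <= r ^+ 2 := sqr_ge0 r.
    (* Young with weight [lb / 4]; added to [lambda / 2] it gives at most [3/4 lb]. *)
    have : 0 <= (mu * D - lb / 2 * r) ^+ 2 / lb by rewrite divr_ge0 ?sqr_ge0 // ltW.
    have -> : (mu * D - lb / 2 * r) ^+ 2 / lb =
      (mu * D) ^+ 2 / lb - mu * D * r + lb / 4 * r ^+ 2 by field; exact: lt0r_neq0.
    have : lambda * r ^+ 2 <= lb * r ^+ 2 by rewrite ler_wpM2r.
    move: ((mu * D) ^+ 2 / lb) => c; lra.
Qed.
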